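(* For any set of $n$ red points and $n$ blue points in the plane $\mathbb{R}^2$, there exists a red-blue Tverberg matching; that is, there exists a perfect matching $\mathcal{M}$ of the $2n$ points, each edge of which joins a red point to a blue point, such that $$\bigcap_{rb\in \mathcal{M}} B(rb)\neq\emptyset .$$
   Context: For two points $x,y\in\mathbb{R}^d$, $B(xy)$ denotes the closed Euclidean ball for which the segment $xy$ is a diameter, i.e. the closed ball with center $\frac{x+y}{2}$ and radius $\frac{\|x-y\|}{2}$. A graph $G$ whose vertices are finitely many points in $\mathbb{R}^d$ is called a Tverberg graph if $\bigcap_{xy\in E(G)}B(xy)\neq\emptyset$; a perfect matching that is a Tverberg graph is called a Tverberg matching. A perfect matching is red-blue if every edge connects points of different colors (equivalently, it is given by a bijection from the red points to the blue points). *)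

(* Defs.v *)
From HB Require Import structures.
From mathcomp Require Import all_boot all_order all_algebra.
From mathcomp Require Import finmap.
From mathcomp Require Import boolp classical_sets reals.

Set Implicit Arguments.
Unset Strict Implicit.
Unset Printing Implicit Defensive.

Import Order.TTheory GRing.Theory Num.Theory.

Local Open Scope ring_scope.
Local Open Scope fset_scope.
Local Open Scope classical_set_scope.

(* The norm that MathComp-Analysis puts on row vectors is the sup norm, so the
   Euclidean norm is defined separately. *)
Definition enorm (R : realType) (d : nat) (x : 'rV[R]_d) : R :=
  Num.sqrt (\sum_(i < d) x ord0 i ^+ 2).

Definition eclosed_ball (R : realType) (d : nat) (c : 'rV[R]_d) (r : R) :
    set 'rV[R]_d :=
  [set z | enorm (z - c) <= r].

Definition diametral_ball (R : realType) (d : nat) (x y : 'rV[R]_d) :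
    set 'rV[R]_d :=
  eclosed_ball (2^-1 *: (x + y)) (enorm (x - y) / 2).

(* A finite simple graph whose vertices are points of R^d; edges are unordered
   pairs of distinct vertices. *)
Record pgraph (R : realType) (d : nat) := PGraph {
  vertices : {fset 'rV[R]_d};
  edges : {fset {fset 'rV[R]_d}};
  edgesP : forall e, e \in edges -> (e `<=` vertices)%fset /\ #|` e|%fset = 2%N
}.

(* Each edge xy is visited both as (x, y) and as (y, x), with the same ball.  For
   an edgeless graph the intersection is the whole space. *)
Definition tverberg_graph (R : realType) (d : nat) (G : pgraph R d) : Prop :=
  \bigcap_(p in [set p : 'rV[R]_d * 'rV[R]_d | [fset p.1; p.2]%fset \in edges G])
    diametral_ball p.1 p.2 !=set0.

Definition perfect_matching (R : realType) (d : nat) (G : pgraph R d) : Prop :=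
  forall v, v \in vertices G -> exists! e, e \in edges G /\ v \in e.

Definition tverberg_matching (R : realType) (d : nat) (G : pgraph R d) : Prop :=
  perfect_matching G /\ tverberg_graph G.

Definition red_blue (R : realType) (d : nat) (Red Blue : {fset 'rV[R]_d})
    (G : pgraph R d) : Prop :=
  forall e, e \in edges G ->
    exists r b, [/\ r \in Red, b \in Blue & e = [fset r; b]%fset].

(* Main.v *)
Require Import Defs.
From HB Require Import structures.
From mathcomp Require Import all_boot all_order all_algebra all_fingroup.
From mathcomp Require Import finmap.
From mathcomp Require Import boolp classical_sets reals.
From mathcomp Require Import topology normedtype derive.
From mathcomp Require Import ring lra.

(** Among all bijections from red to blue take one that minimizes the sum of
    the inner products <r, b> over the matched pairs; since the sums of |r|^2
    and |b|^2 do not depend on the bijection, this is the same as maximizing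
    the sum of the squared distances.  Exchanging the partners of two pairs
    cannot decrease the sum, so <r1 - r2, b1 - b2> <= 0 for any two matched
    pairs (antitone_matching).

    Write c = (r + b) / 2 for the center of the ball B(rb) and e = (r - b) / 2,
    so that |e| is its radius.  By the polarization identity the inequality
    above says |c1 - c2| <= |e1 - e2| (midpoint_half_difference): sending each e
    to its c is a 1-Lipschitz map on a finite set.  By Kirszbraun's theorem it
    extends to the origin, and the value z at the origin satisfies
    |z - c| <= |e - 0| for every pair, which says that z lies in every B(rb).

    Only this one-point extension is proved (kirszbraun_at0), by duality.  On
    the simplex of weights t, consider the concave function
      h(t) = sum_i t_i (|c_i|^2 - |e_i|^2) - |sum_i t_i c_i|^2,
    which is the minimum over z of sum_i t_i (|z - c_i|^2 - |e_i|^2).  The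
    Lipschitz condition gives h <= 0 everywhere, and at a maximizer t the first
    order conditions say exactly that z = sum_i t_i c_i satisfies
    |z - c_j|^2 - |e_j|^2 <= h(t) for every j. *)

Set Implicit Arguments.
Unset Strict Implicit.
Unset Printing Implicit Defensive.

Import Order.TTheory GRing.Theory Num.Theory.
Import numFieldNormedType.Exports.

Local Open Scope ring_scope.

(** * The Euclidean inner product and diametral balls *)

Section Dot.
Variables (R : realType) (d : nat).
Implicit Types u v w : 'rV[R]_d.

Definition dot u v : R := \sum_(i < d) u ord0 i * v ord0 i.

Lemma dotC u v : dot u v = dot v u.
Proof. by apply: eq_bigr => i _; rewrite mulrC. Qed.

Lemma dotDl u v w : dot (u + v) w = dot u w + dot v w.
Proof. by rewrite -big_split; apply: eq_bigr => i _; rewrite mxE mulrDl. Qed.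

Lemma dotZl a u v : dot (a *: u) v = a * dot u v.
Proof. by rewrite big_distrr; apply: eq_bigr => i _; rewrite mxE -mulrA. Qed.

Lemma dotDr u v w : dot w (u + v) = dot w u + dot w v.
Proof. by rewrite dotC dotDl !(dotC w). Qed.

Lemma dotZr a u v : dot u (a *: v) = a * dot u v.
Proof. by rewrite dotC dotZl dotC. Qed.

Lemma dotNl u v : dot (- u) v = - dot u v.
Proof. by rewrite -scaleN1r dotZl mulN1r. Qed.

Lemma dotNr u v : dot u (- v) = - dot u v.
Proof. by rewrite dotC dotNl dotC. Qed.

Lemma dot_suml (I : finType) (F : I -> 'rV[R]_d) v :
  dot (\sum_i F i) v = \sum_i dot (F i) v.
Proof.
rewrite /dot exchange_big; apply: eq_bigr => j _.
by rewrite summxE big_distrl.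
Qed.

Lemma dot_ge0 u : 0 <= dot u u.
Proof. by apply: sumr_ge0 => i _; rewrite -expr2 sqr_ge0. Qed.

Definition dotE := (dotDl, dotDr, dotNl, dotNr, dotZl, dotZr).

Lemma ler_enorm u v : (enorm u <= enorm v) = (dot u u <= dot v v).
Proof. by rewrite ler_sqrt //; exact: dot_ge0. Qed.

Lemma enormZ a u : 0 <= a -> enorm (a *: u) = a * enorm u.
Proof.
move=> a0; have -> : enorm (a *: u) = Num.sqrt (a ^+ 2 * dot u u).
  congr Num.sqrt; rewrite big_distrr.
  by apply: eq_bigr => i _; rewrite mxE exprMn -expr2.
by rewrite sqrtrM ?sqr_ge0// sqrtr_sqr ger0_norm.
Qed.

Lemma diametral_ballE u v z : diametral_ball u v z <->
  dot (z - 2^-1 *: (u + v)) (z - 2^-1 *: (u + v)) <=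
  dot (2^-1 *: (u - v)) (2^-1 *: (u - v)).
Proof. by rewrite -ler_enorm enormZ ?invr_ge0// mulrC. Qed.

Lemma diametral_ballC u v z : diametral_ball u v z -> diametral_ball v u z.
Proof.
move/diametral_ballE=> H; apply/diametral_ballE; move: H.
by rewrite (addrC v) -(opprB u v) scalerN !dotE !opprK.
Qed.

(** The two sides differ by <r1 - r2, b1 - b2>, because
    |(u + v) / 2|^2 - |(u - v) / 2|^2 = <u, v>. *)
Lemma midpoint_half_difference r1 b1 r2 b2 : dot (r1 - r2) (b1 - b2) <= 0 ->
  dot (2^-1 *: (r1 + b1) - 2^-1 *: (r2 + b2))
      (2^-1 *: (r1 + b1) - 2^-1 *: (r2 + b2)) <=
  dot (2^-1 *: (r1 - b1) - 2^-1 *: (r2 - b2))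
      (2^-1 *: (r1 - b1) - 2^-1 *: (r2 - b2)).
Proof.
rewrite !dotE (dotC b1 r1) (dotC b2 r2) (dotC b1 r2) (dotC b2 r1).
rewrite (dotC r2 r1) (dotC b2 b1); lra.
Qed.

(** Twice the variance of a random point, written through two independent
    copies of it.  It bounds the variance of the c_i in terms of their mutual
    distances alone, which is all that a Lipschitz condition controls. *)
Lemma weighted_sum_pairs n (t : 'rV[R]_n) (c : 'I_n -> 'rV[R]_d) :
  \sum_i t 0 i = 1 ->
  \sum_i \sum_j t 0 i * t 0 j * dot (c i - c j) (c i - c j) =
  2 * (\sum_i t 0 i * dot (c i) (c i) -
       dot (\sum_i t 0 i *: c i) (\sum_i t 0 i *: c i)).
Proof.
move=> t1; set S := \sum_i t 0 i * dot (c i) (c i).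
set z := \sum_i t 0 i *: c i.
have inner i : \sum_j t 0 i * t 0 j * dot (c i - c j) (c i - c j) =
    t 0 i * dot (c i) (c i) + t 0 i * S - 2 * (t 0 i * dot (c i) z).
  transitivity (\sum_j (t 0 i * dot (c i) (c i) * t 0 j +
      t 0 i * (t 0 j * dot (c j) (c j)) -
      2 * (t 0 i * (t 0 j * dot (c j) (c i))))).
    by apply: eq_bigr => j _; rewrite !dotE (dotC (c i) (c j)); ring.
  rewrite big_split sumrN big_split /= -!big_distrr /= t1 mulr1 -/S.
  congr (_ + _ - 2 * (_ * _)).
  by rewrite dotC dot_suml; apply: eq_bigr => j _; rewrite dotZl.
under eq_bigr do rewrite inner.
rewrite big_split sumrN big_split /= -!big_distrr -big_distrl /= t1 -/S.
suff -> : \sum_i t 0 i * dot (c i) z = dot z z by ring.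
by rewrite dot_suml; apply: eq_bigr => j _; rewrite dotZl.
Qed.

End Dot.

(** * Extending a Lipschitz map to the origin *)

Definition simplex (R : realType) n : set 'rV[R]_n :=
  [set t | (forall i, 0 <= t 0 i) /\ \sum_i t 0 i = 1]%classic.

Lemma continuous_sum_coord (R : realType) n (f : 'I_n -> R) :
  continuous (fun t : 'rV[R]_n => \sum_i t 0 i * f i).
Proof.
apply: continuous_big => [|i _]; first exact: add_continuous.
by move=> t; exact: (cvgM (@coord_continuous R 1 n 0 i t) (cvg_cst _)).
Qed.

Lemma simplex_compact (R : realType) n : compact (@simplex R n).
Proof.
apply: (@subclosed_compact _ _
  [set t : 'rV[R]_n | forall i, `[(0 : R), 1]%classic (t ord0 i)]%classic).
- have -> : simplex (n := n) =
    (\bigcap_(i in setT) ((fun t : 'rV[R]_n => t 0 i) @^-1` [set x | 0 <= x]) `&`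
    (fun t : 'rV[R]_n => \sum_i t 0 i * 1) @^-1` [set x | x = 1])%classic.
    apply/seteqP; split=> t /=; rewrite /simplex /=.
      move=> [t0 t1]; split=> [i _|]; first exact: t0.
      by under eq_bigr do rewrite mulr1.
    move=> [t0 t1]; split=> [i|]; first exact: t0.
    by under eq_bigr do rewrite -[t 0 _]mulr1.
  apply: closedI.
    apply: closed_bigI => i _; apply: preimage_closed; last exact: closed_ge.
    by move=> t _; exact: (@coord_continuous R 1 n 0 i t).
  apply: preimage_closed; last exact: closed_eq.
  by move=> t _; exact: continuous_sum_coord.
- have := @rV_compact R n (fun=> `[(0 : R), 1]%classic).
  by apply => _; exact: segment_compact.
- move=> t [t0 t1] i /=; rewrite in_itv /= t0 -t1 (bigD1 i) //= lerDl.
  exact: sumr_ge0.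
Qed.

(** The first order condition at a one-sided maximum: divide by s and let s
    tend to 0. *)
Lemma le0_of_quadratic (R : realType) (x y : R) : 0 <= y ->
  (forall s, 0 < s -> s <= 1 -> s * x <= s ^+ 2 * y) -> x <= 0.
Proof.
move=> y0 H; rewrite leNgt; apply/negP => x0.
(* This s gives s * y < x; adding 1 to the denominator also keeps s <= 1. *)
have D0 : 0 < x + y + 1 by lra.
set s := x / (x + y + 1).
have s0 : 0 < s by rewrite divr_gt0.
have sD : s * (x + y + 1) = x by rewrite divfK ?gt_eqF.
have s1 : s <= 1 by rewrite ler_pdivrMr // mul1r; lra.
have := H s s0 s1; rewrite expr2 -mulrA ler_pM2l //; nra.
Qed.

(** The value at 0 of a 1-Lipschitz extension of the map e i |-> c i, where
    dot (e i) (e i) is the squared distance from e i to 0. *)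
Lemma kirszbraun_at0 (R : realType) d n (c e : 'I_n -> 'rV[R]_d) :
  (forall i j, dot (c i - c j) (c i - c j) <= dot (e i - e j) (e i - e j)) ->
  exists z, forall i, dot (z - c i) (z - c i) <= dot (e i) (e i).
Proof.
case: n c e => [|n] c e ce; first by exists 0 => -[].
pose a i := dot (c i) (c i) - dot (e i) (e i).
pose z (t : 'rV[R]_n.+1) : 'rV[R]_d := \sum_i t 0 i *: c i.
pose h (t : 'rV[R]_n.+1) := \sum_i t 0 i * a i - dot (z t) (z t).
(* By the variance identity and the Lipschitz hypothesis,
   h t <= - |sum_i t_i e_i|^2. *)
have h_le0 t : simplex t -> h t <= 0.
  move=> [t0 t1].
  have : \sum_i \sum_j t 0 i * t 0 j * dot (c i - c j) (c i - c j) <=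
         \sum_i \sum_j t 0 i * t 0 j * dot (e i - e j) (e i - e j).
    by apply: ler_sum => i _; apply: ler_sum => j _; rewrite ler_wpM2l ?mulr_ge0.
  rewrite !weighted_sum_pairs // ler_pM2l // -/(z t) /h.
  have -> : \sum_i t 0 i * a i =
      \sum_i t 0 i * dot (c i) (c i) - \sum_i t 0 i * dot (e i) (e i).
    by rewrite -sumrB; apply: eq_bigr => i _; rewrite mulrBr.
  have := dot_ge0 (\sum_i t 0 i *: e i); lra.
have delta_simplex j : simplex (delta_mx 0 j : 'rV[R]_n.+1).
  split=> [i|]; first by rewrite mxE ler0n.
  rewrite (bigD1 j) //= big1 => [|i ij]; first by rewrite mxE !eqxx addr0.
  by rewrite mxE (negPf ij).
have z_cont k : continuous (fun t => z t ord0 k).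
  have -> : (fun t => z t ord0 k) =
      (fun t : 'rV[R]_n.+1 => \sum_i t 0 i * c i ord0 k).
    by apply/funext => t; rewrite summxE; apply: eq_bigr => i _; rewrite mxE.
  exact: continuous_sum_coord.
have zz_cont : continuous (fun t => dot (z t) (z t)).
  apply: continuous_big => [|k _]; first exact: add_continuous.
  by move=> t; exact: (cvgM (z_cont k t) (z_cont k t)).
have h_cont : continuous h.
  by move=> t; exact: (cvgB (@continuous_sum_coord _ _ a t) (zz_cont t)).
have [|t] := EVT_max_rV _ (@simplex_compact R n.+1)
    (continuous_subspaceT h_cont).
  by exists (delta_mx 0 0).
rewrite inE => ts ht; have [t0 t1] := ts.
exists (z t) => j.
(* Moving the maximizer t towards the vertex j of the simplex cannot increase
   h, and the derivative of h in that direction compares h t with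
   |z t - c j|^2 - |e j|^2. *)
pose u s := (1 - s) *: t + s *: delta_mx 0 j.
have u_simplex s : 0 < s -> s <= 1 -> simplex (u s).
  move=> s0 s1; split=> [i|].
    by rewrite !mxE addr_ge0 ?mulr_ge0 ?t0 ?ler0n ?subr_ge0 // ltW.
  have -> : \sum_i u s 0 i =
      \sum_i ((1 - s) * t 0 i + s * (delta_mx 0 j : 'rV[R]_n.+1) 0 i).
    by apply: eq_bigr => i _; rewrite !mxE.
  by rewrite big_split -!big_distrr /= t1 (delta_simplex j).2; ring.
have zu s : z (u s) = z t + s *: (c j - z t).
  transitivity (\sum_i ((1 - s) *: (t 0 i *: c i) +
      s *: ((delta_mx 0 j : 'rV[R]_n.+1) 0 i *: c i))).
    by apply: eq_bigr => i _; rewrite !mxE !scalerA -scalerDl.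
  rewrite big_split -!scaler_sumr /= -/(z t) (bigD1 j) //= big1 => [|i ij].
    rewrite mxE !eqxx scale1r addr0 scalerBl scale1r scalerBr.
    by rewrite addrAC addrA.
  by rewrite mxE (negPf ij) scale0r.
have au s : \sum_i u s 0 i * a i =
    (1 - s) * (\sum_i t 0 i * a i) + s * a j.
  transitivity (\sum_i ((1 - s) * (t 0 i * a i) +
      s * ((delta_mx 0 j : 'rV[R]_n.+1) 0 i * a i))).
    by apply: eq_bigr => i _; rewrite !mxE mulrDl !mulrA.
  rewrite big_split -!big_distrr /=; congr (_ + _ * _).
  rewrite (bigD1 j) //= big1 => [|i ij]; first by rewrite mxE !eqxx mul1r addr0.
  by rewrite mxE (negPf ij) mul0r.
have := h_le0 t ts.
have : a j - \sum_i t 0 i * a i - 2 * dot (z t) (c j - z t) <= 0.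
  apply: (@le0_of_quadratic _ _ (dot (c j - z t) (c j - z t))) => [|s s0 s1].
    exact: dot_ge0.
  have := ht (u s); rewrite inE => /(_ (u_simplex s s0 s1)).
  rewrite /h au zu; move: (c j - z t) => v; rewrite !dotE (dotC v (z t)); lra.
rewrite /h /a !dotE (dotC (c j) (z t)); lra.
Qed.

(** * Matchings between two enumerated families of points *)

Section Matching.
Variables (R : realType) (d n : nat) (r b : 'I_n -> 'rV[R]_d).

(** A permutation minimizing the total inner product: composing it with a
    transposition changes the terms at i and j only, and the change is
    - dot (r i - r j) (b (s i) - b (s j)). *)
Lemma antitone_matching : exists s : {perm 'I_n},
  forall i j, dot (r i - r j) (b (s i) - b (s j)) <= 0.
Proof.
pose F (s : {perm 'I_n}) := \sum_i dot (r i) (b (s i)).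
case: (arg_minP F (erefl : xpredT (1%g : {perm 'I_n}))) => s _ smin.
exists s => i j; have [->|ij] := eqVneq i j.
  by rewrite !subrr -(scale0r 0) dotZl mul0r.
have /= := smin (tperm i j * s)%g erefl.
rewrite /F !(bigD1 i (P := xpredT)) //= !(bigD1 j (P := fun k => k != i)) ?(eq_sym j) //=.
rewrite !permM tpermL tpermR.
rewrite [X in _ <= _ + (_ + X)](eq_bigr (fun k => dot (r k) (b (s k)))); last first.
  by move=> k /andP[ki kj]; rewrite permM tpermD // eq_sym.
rewrite !dotE; lra.
Qed.

Hypotheses (r_inj : injective r) (b_inj : injective b)
  (rb : forall i j, r i != b j).

Let E := [fset [fset r i; b i] | i in 'I_n]%fset.
Let V := ([fset r i | i in 'I_n] `|` [fset b i | i in 'I_n])%fset.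

Lemma matching_edgesP e : e \in E -> (e `<=` V)%fset /\ #|` e|%fset = 2%N.
Proof.
case/imfsetP => i _ -> /=; split; last by rewrite cardfs2 rb.
apply/fsubsetP => v; rewrite !inE => /orP[]/eqP->.
  by apply/orP; left; apply/imfsetP; exists i.
by apply/orP; right; apply/imfsetP; exists i.
Qed.

Definition matching_graph := PGraph matching_edgesP.

Lemma matching_graph_perfect : perfect_matching matching_graph.
Proof.
suff edge i v : v \in [fset r i; b i]%fset ->
    exists! e, e \in E /\ v \in e.
  by move=> v; rewrite !inE => /orP[]/imfsetP[i _ ->];
    apply: (edge i); rewrite !inE eqxx ?orbT.
move=> vi; exists [fset r i; b i]%fset; split.
  by split=> //; apply/imfsetP; exists i.
move=> _ [/imfsetP[j _ ->] /= vj].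
suff -> : i = j by [].
move: vi vj; rewrite !inE => /orP[]/eqP-> /orP[] /eqP; last exact: b_inj.
- exact: r_inj.
- by move/eqP; rewrite (negPf (rb _ _)).
- by move/esym/eqP; rewrite (negPf (rb _ _)).
Qed.

Lemma matching_graph_tverberg :
  (forall i j, dot (r i - r j) (b i - b j) <= 0) ->
  tverberg_graph matching_graph.
Proof.
move=> anti; have [z zP] := kirszbraun_at0 (fun i j => midpoint_half_difference (anti i j)).
exists z => -[p q] /= /imfsetP[i _ /= pq].
have zi : diametral_ball (r i) (b i) z by apply/diametral_ballE; exact: zP.
(* The edge may be visited with either orientation; p = q is excluded by
   counting the elements of the edge. *)
have pqn : p != q.
  apply/eqP => epq; have := cardfs2 p q; rewrite pq cardfs2 rb epq eqxx //.
have : p \in [fset r i; b i]%fset by rewrite -pq !inE eqxx.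
have : q \in [fset r i; b i]%fset by rewrite -pq !inE eqxx orbT.
rewrite !inE => /orP[]/eqP qE /orP[]/eqP pE; subst p q => //.
- by rewrite eqxx in pqn.
- exact: diametral_ballC.
- by rewrite eqxx in pqn.
Qed.

End Matching.

Lemma fset_enumeration (K : choiceType) n (A : {fset K}) : #|` A|%fset = n ->
  exists2 f : 'I_n -> K, injective f & A = [fset f i | i in 'I_n]%fset.
Proof.
move=> cA; pose f (i : 'I_n) : K := tnth (Tuple (introT eqP cA)) i.
exists f.
  by apply/tuple_uniqP => /=; exact: fset_uniq.
apply/fsetP => x; apply/idP/imfsetP => [xA|[i _ ->]]; last exact: mem_tnth.
by have /tnthP[i xi] : x \in Tuple (introT eqP cA) by []; exists i.
Qed.

Theorem theorem2 (R : realType) (n : nat) (Red Blue : {fset 'rV[R]_2})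
    (cardRed : #|` Red|%fset = n) (cardBlue : #|` Blue|%fset = n)
    (disjRB : [disjoint Red & Blue]%fset) :
  exists M : pgraph R 2,
    [/\ vertices M = (Red `|` Blue)%fset, red_blue Red Blue M &
        tverberg_matching M].
Proof.
have [r r_inj Rr] := fset_enumeration cardRed.
have [b b_inj Bb] := fset_enumeration cardBlue.
have rR i : r i \in Red by rewrite Rr; apply/imfsetP; exists i.
have bB i : b i \in Blue by rewrite Bb; apply/imfsetP; exists i.
have rb i j : r i != b j.
  by apply/eqP => e; have /fdisjointP/(_ _ (rR i)) := disjRB; rewrite e bB.
have [s sP] := antitone_matching r b.
have bs_inj : injective (b \o s) by apply: inj_comp => //; exact: perm_inj.
exists (matching_graph (b := b \o s) (fun i j => rb i (s j))); split.
- rewrite /= Rr Bb; congr (_ `|` _)%fset.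
  apply/fsetP => x; apply/imfsetP/imfsetP => -[i _ ->] /=; first by exists (s i).
  by exists (s^-1 i)%g => //=; rewrite permKV.
- by move=> e /imfsetP[i _ ->]; exists (r i), (b (s i)).
- split; first exact: matching_graph_perfect.
  exact: matching_graph_tverberg.
Qed.
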